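(* Let $p$ and $q$ be prime numbers with $p<q$ and $p \equiv q \equiv 3 \pmod 4$. Then $$\kappa^+(4pq) \equiv 2 \pmod 4.$$
   Context: A real quadratic number is a real irrational root $w$ of a quadratic polynomial with integer coefficients; $w'$ denotes its algebraic conjugate over $\mathbb{Q}$. The discriminant $\mathrm{disc}(w)$ of $w$ is $b^2-4ac$, where $aw^2+bw+c=0$ with $a,b,c\in\mathbb{Z}$, $a>0$, $\gcd(a,b,c)=1$. A real quadratic number $w$ is m-reduced if $w>1$ and $0<w'<1$. For a positive non-square integer $D$, $\kappa^+(D)$ denotes the (finite) number of m-reduced real quadratic numbers $w$ with $\mathrm{disc}(w)=D$. *)

(* Defs.v *)
From HB Require Import structures.
From mathcomp Require Import all_boot all_order all_algebra finmap.
From mathcomp Require Import boolp classical_sets functions cardinality reals.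

Set Implicit Arguments.
Unset Strict Implicit.
Unset Printing Implicit Defensive.

Import Order.TTheory GRing.Theory Num.Theory.

Local Open Scope classical_set_scope.
Local Open Scope ring_scope.

Definition quad_root (R : realType) (a b c : int) (w : R) : Prop :=
  a%:~R * w ^+ 2 + b%:~R * w + c%:~R = 0.

Definition real_quadratic (R : realType) (w : R) : Prop :=
  irrational w /\
  exists a b c : int, a != 0 /\ quad_root a b c w.

(* For a real quadratic number w, exactly one real v is related to w. *)
Definition conjugate (R : realType) (w v : R) : Prop :=
  v != w /\
  exists p : {poly rat},
    [/\ irreducible_poly p, root (map_poly ratr p) w
      & root (map_poly ratr p) v].

(* The discriminant as a functional relation: the triple (a, b, c) is uniquely
   determined by the real quadratic number w. *)
Definition has_disc (R : realType) (w : R) (D : int) : Prop :=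
  exists a b c : int,
    [/\ quad_root a b c w, 0 < a, gcdz (gcdz a b) c = 1
      & D = b ^+ 2 - 4 * a * c].

Definition m_reduced (R : realType) (w : R) : Prop :=
  [/\ real_quadratic w, 1 < w & exists2 v, conjugate w v & 0 < v < 1].

(* fset_set sends an infinite set to the empty one; the set below is finite
   for every positive non-square D. *)
Definition kappa_plus (R : realType) (D : nat) : nat :=
  #|` fset_set [set w : R | m_reduced w /\ has_disc w D%:Z] |.

(* Main.v *)
(** A form f = a x^2 + 2k xy - c y^2 with a, c > 0 and k^2 + ac = N is an edge
   of the river in Conway's topograph of discriminant 4N. The m-reduced numbers
   of discriminant 4N correspond to the primitive edges with f(1, 1) > 0, by
   sending f to 1 - x, where x is the negative root of f(x, 1).
   For N = 1 mod 4, a primitive f takes the values 0, 1, 3 mod 4, in some order,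
   at the three cusps (1, 0), (0, 1), (1, 1) mod 2, so that the edges are
   coloured by the sign of this permutation. Reflecting the river in a vertex
   swaps the colours, while (a, k, c) -> (c, -k, a) keeps the colour and changes
   the sign of f(1, 1); hence kappa^+(4N) is the number of edges of the even
   colour. On these act k -> -k and a <-> c. For N = pq the latter has no fixed
   point, as N is not a sum of two squares, and the former fixes only (1, 0, N)
   and (N, 0, 1), because (p, 0, q) and (q, 0, p) have the odd colour. *)

Require Import Defs.
From mathcomp Require Import all_boot all_order all_algebra reals finmap.
From mathcomp Require Import boolp classical_sets functions cardinality.
From mathcomp Require Import zify ring lra.

Set Implicit Arguments.
Unset Strict Implicit.
Unset Printing Implicit Defensive.

Import Order.TTheory GRing.Theory Num.Theory.

(** * Counting finite sets by means of involutions *)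

Lemma card_fset_set_image (T U : choiceType) (f : T -> U) (A : set T) :
  finite_set A -> {in A &, injective f} ->
  #|` fset_set [set f x | x in A]%classic| = #|` fset_set A|.
Proof.
move=> finA injf; rewrite fset_set_image // card_in_imfset //= => x y.
by rewrite !in_fset_set //; apply: injf.
Qed.

(** The involution [f] exchanges the part of [A] inside [P] with the part outside, so these are
    equinumerous halves. *)
Lemma card_fset_set_swap (T : choiceType) (A P : set T) (f : T -> T) :
  finite_set A ->
  (forall x, A x -> [/\ A (f x), f (f x) = x & P (f x) <-> ~ P x]) ->
  #|` fset_set A| = (2 * #|` fset_set (A `&` P)%classic|)%N.
Proof.
move=> finA Af.
have finAP : finite_set (A `&` P)%classic by apply: finite_setIl.
have AE : A = ((A `&` P) `|` [set f x | x in A `&` P])%classic.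
  apply/seteqP; split=> [x Ax|x [[]//|[y [Ay _] <-]]]; last by case: (Af y Ay).
  have [Afx ffx Pfx] := Af x Ax; have [Px|nPx] := pselect (P x); first by left.
  by right; exists (f x) => //; split=> //; apply/Pfx.
rewrite {1}AE fset_setU //; last exact: finite_image.
rewrite cardfsU -fset_setI //; last exact: finite_image.
rewrite (_ : (_ `&` [set f x | x in _])%classic = set0).
  rewrite fset_set0 cardfs0 subn0 card_fset_set_image ?mul2n ?addnn//.
  move=> x y; rewrite !inE => -[Ax _] [Ay _] fxy.
  by have [_ <- _] := Af x Ax; have [_ <- _] := Af y Ay; rewrite fxy.
apply/seteqP; split=> // x [[_ Px] [y [Ay Py] yE]].
by have [_ _ PN] := Af y Ay; rewrite -yE in Px; case: (PN.1 Px).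
Qed.

(** * Squarefree numbers, products of two primes and sums of two squares *)

(** In lowest terms the denominator of [x] would divide the numerator, hence be 1; then [N] is a
    perfect square, and being squarefree it is 1. *)
Lemma sqr_rat_neq (N : nat) (x : rat) :
  (forall d, (d ^ 2 %| N)%N -> d = 1%N) -> N <> 1%N -> (x ^+ 2 != N%:R)%R.
Proof.
move=> sqfN N1; apply/eqP => xN; apply: N1; apply: (sqfN).
have eqN : (`|numq x| ^ 2 = N * `|denq x| ^ 2)%N.
  have: ((numq x ^+ 2)%:~R == (N%:Z * denq x ^+ 2)%:~R :> rat)%R.
    rewrite rmorphXn intrM rmorphXn /= -[(N%:Z)%:~R%R]/(N%:R%R) -xN.
    by rewrite numqE exprMn.
  rewrite eqr_int => /eqP E.
  by have := congr1 absz E; rewrite abszM !abszX.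
have dn : (`|denq x| %| `|numq x|)%N.
  by rewrite -(@dvdn_pexp2r _ _ 2) // eqN dvdn_mull.
have d1 : `|denq x|%N = 1%N.
  by have := coprime_num_den x; rewrite /coprime gcdnC (gcdn_idPl dn) => /eqP.
move: eqN; rewrite d1 exp1n muln1 => eqN.
suff n1 : `|numq x|%N = 1%N by rewrite -eqN n1.
by apply: sqfN; rewrite eqN.
Qed.

Lemma mul_primes_squarefree p q d : prime p -> prime q -> p <> q ->
  (d ^ 2 %| p * q)%N -> d = 1%N.
Proof.
move=> pp pq /eqP npq dd.
have [||//] := ltngtP d 1.
  rewrite ltnS leqn0 => /eqP d0; move: dd; rewrite d0 exp0n // dvd0n muln_eq0.
  by rewrite !eqn0Ngt !prime_gt0.
move=> /pdiv_prime; set r := pdiv d => pr.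
have : (r ^ 2 %| p * q)%N.
  by apply: dvdn_trans dd; rewrite dvdn_exp2r // pdiv_dvd.
have [p0 q0] := (prime_gt0 pp, prime_gt0 pq).
(* The exponent of [r] in [p * q] is at most 1 because the two primes differ. *)
rewrite pfactor_dvdn ?muln_gt0 ?p0 // lognM // !logn_prime //.
by case: (r =P p) npq => [->|_]; [case: (p =P q)|case: (r =P q)].
Qed.

Lemma muln_eq_mul_primes p q x y : prime p -> prime q -> (x * y = p * q)%N ->
  [\/ x = 1%N /\ y = (p * q)%N, x = (p * q)%N /\ y = 1%N,
      x = p /\ y = q | x = q /\ y = p].
Proof.
move=> pp pq.
have p_dvd u v : (u * v = p * q)%N -> (p %| u)%N ->
    u = (p * q)%N /\ v = 1%N \/ u = p /\ v = q.
  move=> uv /dvdnP[d uE].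
  have dv : (d * v = q)%N.
    apply/eqP; rewrite -(eqn_pmul2l (prime_gt0 pp)) -uv uE.
    by rewrite mulnA (mulnC p).
  have : (d %| q)%N by rewrite -dv dvdn_mulr.
  have [_ dvq] := primeP pq; move=> /dvq/orP[]/eqP dE.
    by right; move: uE dv; rewrite dE !mul1n.
  left; rewrite uE dE mulnC; split=> //.
  by apply/eqP; rewrite -(eqn_pmul2l (prime_gt0 pq)) -{1}dE dv muln1.
move=> xy; have : (p %| x * y)%N by rewrite xy dvdn_mulr.
rewrite Euclid_dvdM // => /orP[] /p_dvd.
  by move=> /(_ y xy)[[-> ->]|[-> ->]]; [constructor 2 | constructor 3].
rewrite mulnC in xy.
by move=> /(_ x xy)[[-> ->]|[-> ->]]; [constructor 1 | constructor 4].
Qed.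

(** In the field with [p] elements [X^2 = - Y^2]. Raising this to the odd power [(p - 1) / 2] and
    applying Fermat gives [X * Y = - X * Y], so one of the two vanishes, and then so does the
    other. *)
Lemma dvdn_sum_sq p (x y : nat) : prime p -> p = 3 %[mod 4] ->
  (p %| x ^ 2 + y ^ 2)%N -> (p %| x)%N /\ (p %| y)%N.
Proof.
move=> pp p3; have Fp := pchar_Fp pp.
rewrite !(dvdn_pcharf Fp) natrD !natrX.
set X := x%:R%R; set Y := y%:R%R => /eqP XY.
have X2 : (X ^+ 2 = - Y ^+ 2)%R by apply/eqP; rewrite -addr_eq0 XY.
(* This is [p] itself, written so that the oddness of [(p - 1) / 2] is visible. *)
pose n := (2 * (p %/ 4).*2.+1).+1.
have fermat (z : nat) : (z%:R ^+ n = z%:R :> 'F_p)%R.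
  rewrite -natrX -[LHS]Fp_nat_mod // (_ : n = p) ?fermat_little ?Fp_nat_mod //.
  by rewrite /n; lia.
have XnY : (X ^+ n * Y = - X * Y ^+ n)%R.
  rewrite /n (exprS X) (exprS Y) !exprM X2 exprNn -signr_odd /= odd_double.
  by ring.
have : ((X * Y) *+ 2 = 0)%R.
  move: XnY; rewrite !fermat mulNr => XYN.
  by rewrite mulr2n {1}XYN addNr.
rewrite -mulr_natr => /eqP.
rewrite !mulf_eq0 -(dvdn_pcharf Fp 2) dvdn_prime2 //.
have -> : (p == 2) = false by apply/eqP => p2; move: p3; rewrite p2.
rewrite orbF => /orP[] /eqP Z; move: XY; rewrite Z expr0n ?add0r ?addr0 /=.
  by move=> /eqP; rewrite sqrf_eq0 eqxx.
by move=> /eqP; rewrite sqrf_eq0 eqxx.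
Qed.

Lemma sum_sq_neq_mul_primes p q (x y : nat) : prime p -> prime q -> p <> q ->
  p = 3 %[mod 4] -> (x ^ 2 + y ^ 2 <> p * q)%N.
Proof.
move=> pp pq npq p3 E.
have [|px py] := @dvdn_sum_sq p x y pp p3; first by rewrite E dvdn_mulr.
have p1 : p = 1%N.
  apply: (mul_primes_squarefree pp pq npq).
  by rewrite -E dvdn_add // dvdn_exp2r.
by rewrite p1 in pp.
Qed.

(** * Residues modulo 4, colours and the count of forms *)

Section Forms.
Local Open Scope ring_scope.
Local Open Scope classical_set_scope.

(** If [k] is even, then [a * c] is 1 mod 4, so [a] and [c] are both 1 or both 3. If [k] is odd,
    then 4 divides [a * c], and since one factor is odd the other takes all of the 4. *)
Lemma mod4_residues (n a k c : int) : k ^+ 2 + a * c = 4 * n + 1 ->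
  ~~ ((2 %| a)%Z && (2 %| c)%Z) ->
  [\/ [/\ (k %% 2)%Z = 0, (a %% 4)%Z = 1 & (c %% 4)%Z = 1],
      [/\ (k %% 2)%Z = 0, (a %% 4)%Z = 3 & (c %% 4)%Z = 3],
      [/\ (k %% 2)%Z = 1, (a %% 4)%Z = 0 & (c %% 2)%Z = 1] |
      [/\ (k %% 2)%Z = 1, (a %% 2)%Z = 1 & (c %% 4)%Z = 0]].
Proof.
have res (x : int) : exists y : int,
    [\/ x = 4 * y, x = 4 * y + 1, x = 4 * y + 2 | x = 4 * y + 3].
  exists (x %/ 4)%Z; have [?|[?|[?|?]]] : (x %% 4)%Z = 0 \/ (x %% 4)%Z = 1 \/
    (x %% 4)%Z = 2 \/ (x %% 4)%Z = 3 by lia.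
  - by constructor 1; lia.
  - by constructor 2; lia.
  - by constructor 3; lia.
  - by constructor 4; lia.
have [k' Hk] := res k; have [a' Ha] := res a; have [c' Hc] := res c.
rewrite expr2.
case: Hk => ->; case: Ha => ->; case: Hc => -> E H;
  solve [exfalso; lia | constructor 1; split; lia | constructor 2; split; lia
        | constructor 3; split; lia | constructor 4; split; lia].
Qed.

(* The triple (a, k, c) stands for the form a x^2 + 2k xy - c y^2. When N is
   squarefree, only the prime 2 can prevent it from being primitive. *)
Definition forms (N : nat) : set (int * int * int) :=
  [set u | let: (a, k, c) := u in
    [/\ 0 < a, 0 < c, k ^+ 2 + a * c = N%:Z
      & ~~ ((2 %| a)%Z && (2 %| c)%Z)]].

Definition pos11 : set (int * int * int) :=
  [set u | let: (a, k, c) := u in 0 < a + 2 * k - c].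

(* The values (a, -c, a + 2k - c) of the form mod 4 are a cyclic permutation of
   (1, 3, 0); modulo 4 the last value is determined by the first two. *)
Definition even_colour : set (int * int * int) :=
  [set u | let: (a, k, c) := u in
    [|| ((a %% 4)%Z == 1) && ((c %% 4)%Z == 1),
        ((a %% 4)%Z == 0) && ((c %% 4)%Z == 3)
      | ((a %% 4)%Z == 3) && ((c %% 4)%Z == 0)]].

Lemma finite_forms N : finite_set (forms N).
Proof.
pose I : set int := [set z | `|z| <= N%:Z].
have finI : finite_set I.
  apply: (@sub_finite_set _ _
    ([set n%:Z | n in `I_N.+1] `|` [set - n%:Z | n in `I_N.+1])).
    rewrite /I => z /= zN; have [z0|z0] := leP 0 z.
      by left; exists `|z|%N => /=; lia.
    by right; exists `|z|%N => /=; lia.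
  by rewrite finite_setU; split; apply: finite_image; apply: finite_II.
apply: (@sub_finite_set _ _ ((I `*` I) `*` I)); last first.
  by do 2?apply: finite_setX.
move=> [[a k] c] [a0 c0 E _]; rewrite /I /=; split; [split|] => /=; nia.
Qed.

(** Both sides are twice the number of forms lying in [pos11] and in [even_colour]. *)
Lemma card_pos11_forms N : N = 1 %[mod 4] ->
  (forall m : nat, (m ^ 2)%N <> N) ->
  #|` fset_set (forms N `&` pos11)| = #|` fset_set (forms N `&` even_colour)|.
Proof.
move=> N1 sqN; have finU := finite_forms N.
have [n NE] : exists n : int, N%:Z = 4 * n + 1 by exists (N %/ 4)%N; lia.
(* [z] turns [f(x, y)] into [f(x, x - y)]: it exchanges the values at (1, 0) and (1, 1), both
   positive here. [t] turns [f(x, y)] into [- f(y, x)]; its transposition of cusps and its exchange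
   of the residues 1 and 3 cancel in the colour. *)
pose z (u : int * int * int) :=
  let: (a, k, c) := u in (a + 2 * k - c, c - k, c).
pose t (u : int * int * int) := let: (a, k, c) := u in (c, - k, a).
rewrite (@card_fset_set_swap _ _ even_colour z); last 2 first.
- exact: finite_setIl.
- move=> [[a k] c] [[a0 c0 E ev] /= g].
  have H := mod4_residues (etrans E NE) ev.
  rewrite /z /=; split.
  + split=> /=; last by lia.
    by split=> //; [rewrite -E; ring | case: H => -[]; lia].
  + by congr (_, _, _); ring.
  + by case: H => -[]; lia.
rewrite [RHS](@card_fset_set_swap _ _ pos11 t); last 2 first.
- exact: finite_setIl.
- move=> [[a k] c] [[a0 c0 E ev] /= col]; rewrite /t /=; split.
  + split=> /=; last by lia.
    by split=> //; [rewrite -E; ring | lia].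
  + by rewrite opprK.
  (* The value at (1, 1) is nonzero, since otherwise [N = (k + a)^2]. *)
  + have : a + 2 * k - c != 0.
      apply/eqP => g0; apply: (sqN (absz (k + a))).
      suff: (k + a) ^+ 2 = N%:Z by move/(congr1 absz); rewrite abszX.
      by rewrite -E (_ : c = a + 2 * k); [ring | lia].
    by lia.
by rewrite setIAC.
Qed.

Lemma card_even_colour_forms p q : prime p -> prime q -> (p < q)%N ->
  p = 3 %[mod 4] -> q = 3 %[mod 4] ->
  #|` fset_set (forms (p * q) `&` even_colour)| = 2 %[mod 4].
Proof.
move=> pp pq ltpq p3 q3; have npq : p <> q by lia.
set V := _ `&` even_colour; have finU := finite_forms (p * q).
have finV : finite_set V by exact: finite_setIl.
pose k0 : set (int * int * int) := [set u | u.1.2 = 0].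
pose kpos : set (int * int * int) := [set u | 0 < u.1.2].
pose lt_ac : set (int * int * int) := [set u | u.1.1 < u.2].
pose s (u : int * int * int) := let: (a, k, c) := u in (a, - k, c).
pose t (u : int * int * int) := let: (a, k, c) := u in (c, k, a).
have -> : V = (V `&` k0) `|` (V `\` k0) by rewrite setUIDK.
rewrite fset_setU; [|exact: finite_setIl|exact: finite_setD].
rewrite cardfsU -fset_setI; [|exact: finite_setIl|exact: finite_setD].
rewrite setIDA (_ : V `&` k0 `&` V `\` k0 = set0); last first.
  by apply/seteqP; split=> // u [[[_ ?] _]].
rewrite fset_set0 cardfs0 subn0.
(* Two successive halvings make the number of forms with [k] nonzero a multiple of 4; the two forms
   with [k = 0] give the residue. *)
rewrite (@card_fset_set_swap _ (V `\` k0) kpos s); last 2 first.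
- exact: finite_setD.
- move=> [[a k] c] [[[a0 c0 E ev] col] /eqP/= nk]; rewrite /s /=; split.
  + split; last by rewrite /k0 /=; lia.
    by split=> //; split=> //; rewrite sqrrN.
  + by rewrite opprK.
  + by rewrite /kpos /=; lia.
rewrite (@card_fset_set_swap _ (_ `&` kpos) lt_ac t); last 2 first.
- by apply: finite_setIl; exact: finite_setD.
- move=> [[a k] c] [[[[a0 c0 E ev] col] /= nk] kp]; rewrite /t /=; split=> //.
  + split=> //; split=> //; split; last by move: col => /=; lia.
    by split=> //; [rewrite [c * a]mulrC | rewrite andbC].
  + have : a != c.
      apply/eqP => ac.
      apply: (@sum_sq_neq_mul_primes p q `|k| `|a| pp pq npq p3).
      apply/eqP; rewrite -eqz_nat PoszD -!abszX !gez0_abs ?sqr_ge0 // -E -ac.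
      by rewrite -expr2.
    by rewrite /lt_ac /=; lia.
rewrite (_ : V `&` k0 =
  [set (1, 0, (p * q)%N%:Z)] `|` [set ((p * q)%N%:Z, 0, 1)]).
  rewrite fset_setU // !fset_set1 cardfs2.
  suff -> : (1, 0 : int, (p * q)%N%:Z) != ((p * q)%N%:Z, 0, 1).
    by rewrite /= -modnDmr mulnA modnMr.
  by apply/eqP => -[]; have := prime_gt1 pp; have := prime_gt1 pq; nia.
have pq1 : ((p * q) %% 4 = 1)%N by rewrite -modnMml -modnMmr p3 q3.
apply/seteqP; split.
  move=> [[a k] c] [[[a0 c0 E ev] /= col]]; rewrite /k0 /= => k0E.
  rewrite k0E expr0n add0r /= in E; rewrite k0E.
  have acE : (`|a| * `|c| = p * q)%N by rewrite -abszM E.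
  case: (muln_eq_mul_primes pp pq acE) => -[aE cE].
  - by left; congr (_, _, _); lia.
  - by right; congr (_, _, _); lia.
  (* The factorisations [p * q] and [q * p] have both entries 3 mod 4, which [even_colour]
     excludes. *)
  - by lia.
  - by lia.
have pq0 : (0 < p * q)%N by rewrite muln_gt0 !prime_gt0.
move=> _ [->|->]; (split; [split; [split|]|]) => //=; try lia.
Qed.

(** * Quadratic polynomials, conjugates and the number attached to a form *)

Definition quad_poly (a b c : int) : {poly rat} :=
  a%:~R *: 'X^2 + b%:~R *: 'X + (c%:~R)%:P.

Lemma horner_quad_poly a b c x :
  (quad_poly a b c).[x] = a%:~R * x ^+ 2 + b%:~R * x + c%:~R.
Proof. by rewrite /quad_poly !hornerE. Qed.

Lemma root_quad_poly (R : realType) a b c (w : R) :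
  root (map_poly ratr (quad_poly a b c)) w <-> quad_root a b c w.
Proof.
rewrite rootE /quad_poly !rmorphD /=.
rewrite !map_polyZ map_polyX map_polyXn map_polyC /=.
rewrite !(hornerD, hornerZ, hornerX, hornerXn, hornerC) !ratr_int /quad_root.
by split=> /eqP.
Qed.

Lemma size_quad_poly a b c : a != 0 -> size (quad_poly a b c) = 3%N.
Proof.
move=> a0; have a0' : a%:~R != 0 :> rat by rewrite intr_eq0.
rewrite /quad_poly -addrA size_polyDl size_scale ?size_polyXn //.
rewrite (leq_ltn_trans (size_polyD _ _)) // gtn_max size_polyC.
by rewrite (leq_ltn_trans (size_scale_leq _ _)) ?size_polyX //; case: eqP.
Qed.

(** An irreducible polynomial sharing the root [w] with the quadratic cannot be coprime to it, hence
    divides it and passes on its root [v]. *)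
Lemma conjugate_quad_root (R : realType) a b c (w v : R) :
  conjugate w v -> quad_root a b c w -> quad_root a b c v.
Proof.
move=> [_ [p [irrp pw pv]]] /root_quad_poly qw; apply/root_quad_poly.
suff : p %| quad_poly a b c.
  rewrite -(dvdp_map (ratr : {rmorphism rat -> R})) => /dvdpP[r ->].
  by rewrite rootM pv orbT.
apply: contraT; rewrite -irreducible_poly_coprime //.
rewrite -(coprimep_map (ratr : {rmorphism rat -> R})) => /coprimep_root/(_ pw).
by move: qw; rewrite rootE => ->.
Qed.

(** The number is [1 - x], with [x = - (k + sqrt N) / a] the negative root of [a x^2 + 2k x - c]. *)
Definition root_of_form (R : realType) (N : nat) (u : int * int * int) : R :=
  let: (a, k, c) := u in 1 + (k%:~R + Num.sqrt N%:R) / a%:~R.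

(** * Forms and m-reduced numbers of discriminant 4N, for squarefree N *)

Section Squarefree.
Variables (R : realType) (N : nat).
Hypothesis sqfN : forall d, (d ^ 2 %| N)%N -> d = 1%N.
Hypothesis N1 : (1 < N)%N.
Let s : R := Num.sqrt N%:R.

Lemma sqr_sqrtN : s ^+ 2 = N%:R.
Proof. by rewrite sqr_sqrtr. Qed.

Lemma sqrt_irrational (x : rat) : s != ratr x.
Proof.
have N1' : N <> 1%N by lia.
apply/eqP => sx; have /eqP := sqr_rat_neq x sqfN N1'; apply.
apply: (fmorph_inj (ratr : {rmorphism rat -> R})).
by rewrite rmorphXn /= -sx sqr_sqrtN ratr_nat.
Qed.

Lemma root_of_form_irrational (a k c : int) : a != 0 ->
   irrational (root_of_form R N (a, k, c)).
Proof.
move=> a0 [x _ /= wx]; have a0' : a%:~R != 0 :> R by rewrite intr_eq0.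
have /eqP[] := sqrt_irrational ((x - 1) * a%:~R - k%:~R).
rewrite rmorphB rmorphM rmorphB rmorph1 /= !ratr_int wx /s.
by field.
Qed.

Lemma root_of_form_inj : {in forms N &, injective (root_of_form R N)}.
Proof.
move=> [[a k] c] [[a' k'] c'].
rewrite !inE => -[a0 c0 E _] [a'0 c'0 E' _] ww.
have A0 : a%:~R != 0 :> R by rewrite intr_eq0 gt_eqF.
have A'0 : a'%:~R != 0 :> R by rewrite intr_eq0 gt_eqF.
have eqw : (k%:~R + s) * a'%:~R = (k'%:~R + s) * a%:~R.
  move: ww => /= /addrI ww.
  by apply/eqP; rewrite -eqr_div //; apply/eqP.
have aa' : a = a'.
  apply/eqP/contraT => naa'.
  have daa' : (a' - a)%:~R != 0 :> R by rewrite intr_eq0 subr_eq0 eq_sym.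
  (* If [a] and [a'] differ, [eqw] is linear in [s] and its solution is rational. *)
  have /eqP[] := sqrt_irrational ((k' * a - k * a')%:~R / (a' - a)%:~R).
  rewrite rmorphM fmorphV /= !ratr_int; apply: (mulIf daa'); rewrite mulfVK //.
  rewrite !rmorphB /= !rmorphM /=; lra.
have kk' : k = k'.
  move: eqw; rewrite aa' => /(mulIf A'0)/addIr/eqP; rewrite eqr_int => /eqP.
  done.
have cc' : c = c'.
  apply: (@mulfI _ a); first by rewrite gt_eqF.
  by apply: (@addrI _ (k ^+ 2)); rewrite E {1}kk' {1}aa' E'.
by rewrite aa' kk' cc'.
Qed.

(** The square of the gcd divides the discriminant [4 * N]. The gcd is odd, as otherwise [a] and [c]
    would both be even; so its square divides the squarefree [N]. *)
Lemma forms_gcd (a k c : int) : forms N (a, k, c) ->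
  gcdz (gcdz a (- 2 * (a + k))) (a + 2 * k - c) = 1.
Proof.
move=> [a0 c0 E ev].
set g := gcdz _ _; set b := - 2 * (a + k) in g *; set f := a + 2 * k - c in g *.
have ga : (g %| a)%Z := dvdz_trans (dvdz_gcdl _ _) (dvdz_gcdl _ _).
have gb : (g %| b)%Z := dvdz_trans (dvdz_gcdl _ _) (dvdz_gcdr _ _).
have gf : (g %| f)%Z := dvdz_gcdr _ _.
have g2 : coprime (`|g| ^ 2) 4.
  rewrite (_ : 4%N = (2 ^ 2)%N) // coprime_pexpl // coprime_pexpr // coprimen2.
  apply: contraR ev; rewrite -dvdn2 => g2.
  have dg (x : int) : (g %| x)%Z -> (2 %| x)%Z.
    by apply: dvdz_trans; rewrite dvdzE.
  by move: (dg _ ga) (dg _ gf) => /=; rewrite /f; lia.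
have : (`|g| ^ 2 %| 4 * N)%N.
  have D : (4 * N)%N%:Z = b ^+ 2 - 4 * a * f by rewrite PoszM -E /b /f; ring.
  have : (g ^+ 2 %| (4 * N)%N%:Z)%Z.
    rewrite D rpredB //; first exact: dvdz_exp2r.
    by rewrite -mulrA dvdz_mull // expr2 dvdz_mul.
  by rewrite dvdzE abszX.
by rewrite Gauss_dvdr // => /sqfN gn; rewrite -(gez0_abs (_ : 0 <= g)) ?gn.
Qed.

Lemma m_reduced_root_of_form (u : int * int * int) :
  forms N u -> pos11 u ->
  m_reduced (root_of_form R N u) /\ has_disc (root_of_form R N u) (4 * N)%N%:Z.
Proof.
case: u => [[a k] c] Fu; have [a0 c0 E _] := Fu; rewrite /pos11 /= => g0.
set w := 1 + _; pose v : R := 1 + (k%:~R - s) / a%:~R.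
have an0 : a != 0 by rewrite gt_eqF.
have A0 : 0 < a%:~R :> R by rewrite ltr0z.
have An0 : a%:~R != 0 :> R by rewrite gt_eqF.
have C0 : 0 < c%:~R :> R by rewrite ltr0z.
have G0 : 0 < a%:~R + 2 * k%:~R - c%:~R :> R.
  by rewrite -(ltr0z R) rmorphB rmorphD rmorphM /= in g0.
have s0 : 0 <= s := sqrtr_ge0 _.
have s2 : s ^+ 2 = k%:~R ^+ 2 + a%:~R * c%:~R.
  by rewrite sqr_sqrtN -[N%:R]/((N%:Z)%:~R) -E rmorphD rmorphXn rmorphM.
have AC0 : 0 < a%:~R * c%:~R :> R := mulr_gt0 A0 C0.
have AG0 : 0 < a%:~R * (a%:~R + 2 * k%:~R - c%:~R) :> R := mulr_gt0 A0 G0.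
(* From [s^2 - k^2 = a * c > 0] and [(a + k)^2 - s^2 = a * (a + 2k - c) > 0] follows
   [|k| < s < a + k], which amounts to [w > 1] and [0 < v < 1]. *)
have ks : 0 < k%:~R + s by nra.
have sk : k%:~R - s < 0 by nra.
have aks : 0 < a%:~R + (k%:~R - s) by nra.
pose b := - 2 * (a + k); pose f := a + 2 * k - c.
have quad (e : R) : e ^+ 2 = s ^+ 2 ->
    quad_root a b f (1 + (k%:~R + e) / a%:~R).
  move=> e2; rewrite /quad_root /b /f !(rmorphB, rmorphD, rmorphM, rmorphN) /=.
  have -> : c%:~R = (e ^+ 2 - k%:~R ^+ 2) / a%:~R :> R.
    by rewrite e2 s2; field.
  by field.
have qw : quad_root a b f w by exact: quad.
have qv : quad_root a b f v by apply: quad; rewrite sqrrN.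
split; last first.
  exists a, b, f; split=> //; first exact: forms_gcd.
  by rewrite PoszM -E /b /f; ring.
split.
- by split; [exact: root_of_form_irrational | exists a, b, f].
- by rewrite /w ltrDl divr_gt0.
exists v.
  split.
    apply/eqP => vw; have : k%:~R - s = k%:~R + s :> R.
      by apply: (mulIf (invr_neq0 An0)); apply: addrI vw.
    by nra.
  exists (quad_poly a b f); split; [|exact/root_quad_poly|exact/root_quad_poly].
  (* A rational root [x] would make [N] the square of the rational [a * x - (a + k)]. *)
  apply: cubic_irreducible => [|x]; first by rewrite size_quad_poly.
  apply/negP; rewrite rootE horner_quad_poly => /eqP qx.
  have N1' : N <> 1%N by lia.
  have /eqP := sqr_rat_neq (a%:~R * x - (a + k)%:~R) sqfN N1'; apply.
  rewrite -[N%:R]/((N%:Z)%:~R) -E; move: qx; rewrite /b /f.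
  by rewrite !(rmorphB, rmorphD, rmorphM, rmorphN, rmorphXn) /= => qx; nra.
rewrite /v gtrDl pmulr_llt0 ?invr_gt0 // sk andbT.
by rewrite -(pmulr_lgt0 _ A0) mulrDl mul1r mulfVK.
Qed.

Lemma m_reduced_form (w : R) :
  m_reduced w -> has_disc w (4 * N)%N%:Z ->
  exists2 u, forms N u /\ pos11 u & w = root_of_form R N u.
Proof.
move=> [_ w1 [v wv /andP[v0 v1]]] [a [b [f [qw a0 g1 D]]]].
have qv := conjugate_quad_root wv qw; have [/eqP vw _] := wv.
(* The discriminant is a multiple of 4, so [b] is even; this reads off [k]. *)
have [k bE] : exists k : int, b = - 2 * (a + k).
  exists (- (b %/ 2)%Z - a); suff : (b %% 2)%Z = 0 by lia.
  have : ~~ odd (`|b| ^ 2); last by rewrite oddX /=; lia.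
  have : b ^+ 2 = (4 * N)%N%:Z + 4 * (a * f) by rewrite D; ring.
  by rewrite -abszX => ->; lia.
have A0 : 0 < a%:~R :> R by rewrite ltr0z.
have An0 : a%:~R != 0 :> R by rewrite gt_eqF.
(* Vieta's formulas: the difference of the two equations is divided by [w - v]. *)
have sumE : a%:~R * (w + v) = - b%:~R.
  apply: (mulfI (_ : w - v != 0)).
    by rewrite subr_eq0; apply/eqP => /esym.
  by move: qw qv; rewrite /quad_root; lra.
have prodE : a%:~R * (w * v) = f%:~R.
  by have -> : f%:~R = - (a%:~R * w ^+ 2 + b%:~R * w) :> R;
    move: qw sumE; rewrite /quad_root; nra.
have [c cE] : exists c : int, c = a + 2 * k - f by exists (a + 2 * k - f).
have NE : k ^+ 2 + a * c = N%:Z.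
  apply: (mulfI (_ : 4 != 0 :> int)) => //.
  by rewrite -[RHS]/((4%N)%:Z * N%:Z) -PoszM D cE bE; ring.
have f0 : 0 < f.
  by rewrite -(ltr0z R) -prodE !mulr_gt0 // (lt_trans _ w1).
(* [- c] is the value of the quadratic polynomial at 1, which lies strictly between its roots [v]
   and [w]. *)
have c0 : 0 < c.
  rewrite -(ltr0z R) (_ : c = - (a + b + f)); last by rewrite cE bE; ring.
  rewrite !(rmorphN, rmorphD) /= -prodE -[b%:~R]opprK -sumE.
  rewrite (_ : - _ = a%:~R * ((w - 1) * (1 - v))); last by ring.
  by rewrite !mulr_gt0 // subr_gt0.
have bR : b%:~R = - 2 * (a%:~R + k%:~R) :> R.
  by rewrite bE rmorphM rmorphD.
exists (a, k, c).
  split; last by rewrite /pos11 /= cE; lia.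
  split=> //; apply/negP => /andP[ea ec].
  have : (2 %| gcdz (gcdz a b) f)%Z; last by rewrite g1.
  by rewrite !dvdz_gcd ea bE; move: ea ec; rewrite cE; lia.
suff sE : Num.sqrt N%:R = a%:~R * (w - 1) - k%:~R by rewrite /= sE; field.
have -> : N%:R = (a%:~R * (w - 1) - k%:~R) ^+ 2 :> R.
  rewrite -[LHS]/((N%:Z)%:~R) -NE cE !(rmorphB, rmorphD, rmorphM, rmorphXn) /=.
  have -> : f%:~R = - (a%:~R * w ^+ 2 + b%:~R * w) :> R.
    by apply/eqP; rewrite -addr_eq0 addrC; apply/eqP.
  by rewrite bR; ring.
(* The sign is right because [a * (w - 1) - k] is half of [a * (w - v)]. *)
rewrite sqrtr_sqr ger0_norm //.
have : 0 <= a%:~R * (w - v) by rewrite mulr_ge0 ?subr_ge0 ?ltW // (lt_trans v1).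
by nra.
Qed.

Lemma kappa_plusE :
  kappa_plus R (4 * N) = #|` fset_set (forms N `&` pos11)|.
Proof.
rewrite -(card_fset_set_image (f := root_of_form R N)).
- congr (#|` fset_set _|); apply/seteqP; split=> w /=.
    by move=> [mw /(m_reduced_form mw)[u ? ->]]; exists u.
  by move=> [u [Fu pu] <-]; exact: m_reduced_root_of_form.
- exact/finite_setIl/finite_forms.
- move=> u v; rewrite !inE => -[Fu _] [Fv _].
  by apply: root_of_form_inj; rewrite inE.
Qed.

End Squarefree.
End Forms.

Theorem theorem3p3 (R : realType) (p q : nat)
  (hp : prime p) (hq : prime q) (hpq : (p < q)%N)
  (hp4 : p = 3 %[mod 4]) (hq4 : q = 3 %[mod 4]) :
  kappa_plus R (4 * p * q)%N = 2 %[mod 4].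
Proof.
have npq : p <> q by move=> pq; rewrite pq ltnn in hpq.
have sqf := fun d => @mul_primes_squarefree p q d hp hq npq.
have pq1 : (1 < p * q)%N.
  by have := prime_gt1 hp; have := prime_gt1 hq; nia.
rewrite -mulnA (kappa_plusE R sqf pq1) card_pos11_forms.
- exact: card_even_colour_forms.
- by rewrite -modnMml -modnMmr hp4 hq4.
- move=> m mE; have m1 : m = 1%N by apply: sqf; rewrite -mE.
  by rewrite -mE m1 in pq1.
Qed.
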